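(* Let $R$ be an associative (not necessarily commutative) ring with $1\neq 0$ and let $M$ be a non-zero left $R$-module. (1) The pair $(\mathrm{Spec}^{\mathrm{c}}(M),\tau_m^{\mathrm{c}}(M))$ is a topological space, i.e. $\tau_m^{\mathrm{c}}(M)$ is a topology (a collection of open sets) on $\mathrm{Spec}^{\mathrm{c}}(M)$. (2) If every coprime submodule of $M$ is strongly irreducible, then $M$ is a top$^{\mathrm{c}}$-module.
   Context: Ideals are two-sided. A proper submodule $K\lneq M$ is coprime in $M$ (a coprime submodule) if for every two-sided ideal $I$ of $R$ either $IM+K=M$ or $IM\subseteq K$; $\mathrm{Spec}^{\mathrm{c}}(M)$ is the set of coprime submodules of $M$. For $L\le M$ put $\mathcal{V}^{\mathrm{c}}(L)=\{K\in\mathrm{Spec}^{\mathrm{c}}(M)\mid L\subseteq K\}$ and $\mathcal{X}^{\mathrm{c}}(L)=\{K\in\mathrm{Spec}^{\mathrm{c}}(M)\mid L\nsubseteq K\}$. Let $\mathcal{L}_m(M)=\{IM\mid I \text{ a two-sided ideal of } R\}$ and $\tau_m^{\mathrm{c}}(M)=\{\mathcal{X}^{\mathrm{c}}(L)\mid L\in\mathcal{L}_m(M)\}$. $M$ is a top$^{\mathrm{c}}$-module if $\xi^{\mathrm{c}}(M)=\{\mathcal{V}^{\mathrm{c}}(L)\mid L\le M\}$ is closed under finite unions, equivalently $\tau^{\mathrm{c}}(M)=\{\mathcal{X}^{\mathrm{c}}(L)\mid L\le M\}$ is a topology on $\mathrm{Spec}^{\mathrm{c}}(M)$. A proper submodule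 $L\lneq M$ is strongly irreducible if for all $L_1,L_2\le M$: $L_1\cap L_2\subseteq L$ implies $L_1\subseteq L$ or $L_2\subseteq L$. *)

(* Defs.v *)
From HB Require Import structures.
From mathcomp Require Import all_boot all_algebra.
From mathcomp Require Import boolp classical_sets cardinality.
From mathcomp Require Import topology_structure.

Set Implicit Arguments.
Unset Strict Implicit.
Unset Printing Implicit Defensive.

Import GRing.Theory.

Local Open Scope classical_set_scope.
Local Open Scope ring_scope.

Definition two_sided_ideal (R : nzRingType) (I : set R) : Prop :=
  [/\ GRing.zmod_closed [in I],
      forall a x, I x -> I (a * x)
    & forall a x, I x -> I (x * a)].

Definition is_topology (T : Type) (tau : set (set T)) : Prop :=
  [/\ tau set0,
      tau setT,
      forall U V, tau U -> tau V -> tau (U `&` V)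
    & forall F : set (set T), F `<=` tau -> tau (\bigcup_(U in F) U)].

Section Submodules.
Variables (R : nzRingType) (M : lmodType R).
Implicit Types K L : set M.

Definition submodule L : Prop := GRing.submod_closed [in L].

Definition submod_add K L : set M := [set x + y | x in K & y in L].

Definition ideal_mul (I : set R) : set M :=
  [set x | exists (n : nat) (a : 'I_n -> R) (m : 'I_n -> M),
    (forall i, I (a i)) /\ x = \sum_(i < n) a i *: m i].

Definition coprime_submodule K : Prop :=
  [/\ submodule K, K <> setT
    & forall I : set R, two_sided_ideal I ->
        submod_add (ideal_mul I) K = setT \/ ideal_mul I `<=` K].

Definition strongly_irreducible L : Prop :=
  [/\ submodule L, L <> setT
    & forall L1 L2, submodule L1 -> submodule L2 ->
        L1 `&` L2 `<=` L -> L1 `<=` L \/ L2 `<=` L].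

End Submodules.

Arguments ideal_mul {R} M I.

(* A set coerces to the type of its elements, so that [set (Specc M)] is the
   type of sets of coprime submodules. *)
Definition Specc (R : nzRingType) (M : lmodType R) : set (set M) :=
  [set K | coprime_submodule K].

Arguments Specc {R} M.

Section Spectrum.
Variables (R : nzRingType) (M : lmodType R).
Implicit Types L : set M.

Definition Vc L : set (Specc M) := [set K | L `<=` val K].

Definition Xc L : set (Specc M) := [set K | ~ (L `<=` val K)].

Definition L_m : set (set M) :=
  [set L | exists2 I : set R, two_sided_ideal I & L = ideal_mul M I].

Definition tau_m : set (set (Specc M)) := [set Xc L | L in L_m].

Definition xi_c : set (set (Specc M)) := [set Vc L | L in @submodule R M].

Definition tau_c : set (set (Specc M)) := [set Xc L | L in @submodule R M].

Definition top_c_module : Prop :=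
  forall F : set (set (Specc M)),
    finite_set F -> F `<=` xi_c -> xi_c (\bigcup_(V in F) V).

End Spectrum.

Arguments L_m {R} M.
Arguments tau_m {R} M.
Arguments xi_c {R} M.
Arguments tau_c {R} M.
Arguments top_c_module {R} M.

(* Sanity check: [is_topology] agrees with the library's topological
   structures. *)
Section TopologyOf.
Variables (T : choiceType) (tau : set (set T)) (tauP : is_topology tau).

Definition topology_of of is_topology tau : Type := T.

Let tauT : tau setT. Proof. by case: tauP. Qed.

Let tauI : setI_closed tau. Proof. by case: tauP. Qed.

Let tau_bigU (I : Type) (f : I -> set T) :
  (forall i, tau (f i)) -> tau (\bigcup_i f i).
Proof.
move=> tauf; have -> : \bigcup_i f i = \bigcup_(U in range f) U.
  by rewrite bigcup_image.
by case: tauP => _ _ _; apply=> _ [i _ <-].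
Qed.

HB.instance Definition _ := Choice.on (topology_of tauP).
HB.instance Definition _ :=
  isOpenTopological.Build (topology_of tauP) tauT tauI tau_bigU.

End TopologyOf.

Lemma is_topologyP (T : choiceType) (tau : set (set T)) :
  is_topology tau <->
  exists c : Topological.axioms_ T, @open (Topological.Pack c) = tau.
Proof.
split=> [tauP|[c <-]].
  by exists (Topological.on (topology_of tauP)).
split; [exact: open0|exact: openT|by move=> U V; exact: openI|].
by move=> F sF; apply: bigcup_open => U /sF.
Qed.

Lemma top_c_moduleP (R : nzRingType) (M : lmodType R) :
  top_c_module M <-> is_topology (tau_c M).
Proof.
have VcC L : @Vc R M L = ~` Xc L by rewrite /Vc /Xc; apply/seteqP; split=> K /=;
  [move=> ? ; exact|exact: contrapT].
have XcC L : @Xc R M L = ~` Vc L by [].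
have sub0 : submodule [set (0 : M)].
  by split=> [|a u v]; rewrite !inE//= => -> ->; rewrite scaler0 addr0.
have subT : submodule [set: M] by split=> [|a u v]; rewrite !inE.
have subK (K : Specc M) : submodule (val K).
  by case: K => K /= /set_mem [].
have X0 : @Xc R M [set 0] = set0.
  apply/seteqP; split=> // K /=; apply=> x ->.
  by have [/set_mem] := subK K.
have XT : @Xc R M setT = setT.
  apply/seteqP; split=> // K _ /= sK.
  case: K sK => K /= /set_mem [_ + _] sK; apply; exact/seteqP.
split=> [topM|[_ tauT tauI _]].
  split.
  - by exists [set 0].
  - by exists setT.
  - move=> _ _ [L1 sL1 <-] [L2 sL2 <-].
    have [] := topM [set Vc L1; Vc L2].
    + exact: finite_set2.
    + by move=> _ [->|->]; [exists L1|exists L2].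
    + move=> L sL LE; exists L => //.
      by rewrite !XcC LE bigcup_setU1 bigcup_set1 setCU.
  - move=> F sF.
    pose S : set M := [set x | forall N, submodule N ->
       (forall L, submodule L -> F (Xc L) -> L `<=` N) -> N x].
    exists S.
      split=> [|a u v]; rewrite !inE.
        by move=> N [/set_mem].
      move=> Su Sv N sN FN; have [_ /(_ a u v)] := sN.
      rewrite !inE; apply; [exact: Su|exact: Sv].
    apply/seteqP; split=> K /=.
      apply: contra_notP => nK x; apply=> // L sL FL; apply: contrapT => LK.
      by apply: nK; exists (Xc L).
    move=> [U FU UK] SK; have [L sL LE] := sF _ FU.
    move: UK; rewrite -LE; apply; apply: subset_trans SK => x Lx N sN FN.
    by apply: FN Lx => //; rewrite LE.
move=> F /finite_seqP[s ->] sF.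
suff [L sL LE] : tau_c M (~` \bigcup_(V in [set` s]) V).
  by exists L => //; apply: setC_inj; rewrite -XcC.
elim: s sF => [|V s IHs] sF.
  have -> : [set` [::]] = set0 :> set (set (Specc M)) by apply/seteqP; split.
  by rewrite bigcup_set0 setC0.
have -> : [set` V :: s] = V |` [set` s].
  apply/seteqP; split=> U /=; rewrite inE; first by case/orP=> [/eqP|]; tauto.
  by case=> [->|->]; rewrite ?eqxx ?orbT.
rewrite bigcup_setU1 setCU; apply: tauI; last first.
  by apply: IHs => U sU; apply: sF; rewrite /= inE [U \in s]sU orbT.
have [L sL <-] : xi_c M V by apply: sF; rewrite /= mem_head.
by exists L.
Qed.

(* Main.v *)
Require Import Defs.
From mathcomp Require Import all_boot all_algebra.
From mathcomp Require Import boolp classical_sets.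
From mathcomp Require Import cardinality.

(** For a submodule [K], [IM] is contained in [K] exactly when [I] is contained
    in the two-sided ideal [Ann (M / K)], so sets [Xc (IM)] are stable under
    unions.  For intersections, if [K] is coprime and [JM + K = M], then
    [IM = I(JM + K)] is contained in [(I `&` J)M + K]; hence [(I `&` J)M] in
    [K] forces [IM] or [JM] in [K].  For the second part, strong irreducibility
    gives [Vc L1 `|` Vc L2 = Vc (L1 `&` L2)]. *)

Import GRing.Theory.

Local Open Scope classical_set_scope.
Local Open Scope ring_scope.

Section Closure.
Variables (R : nzRingType) (M : lmodType R).
Implicit Types (I J : set R) (K L : set M).

Lemma submoduleP K :
  submodule K <->
  [/\ K 0, forall u v, K u -> K v -> K (u + v) & forall a u, K u -> K (a *: u)].
Proof.
split=> [[/set_mem K0 Kl]|[K0 KD KZ]].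
  have KL a u v : K u -> K v -> K (a *: u + v).
    by move=> Ku Kv; apply/set_mem/Kl; apply/mem_set.
  split=> // [u v|a u] Ku; first by rewrite -[u]scale1r; exact: KL.
  by rewrite -[_ *: _]addr0; apply: KL.
split; first exact/mem_set.
by move=> a u v /set_mem Ku /set_mem Kv; apply/mem_set/KD => //; exact: KZ.
Qed.

Lemma submodule_sum K n (f : 'I_n -> M) :
  submodule K -> (forall i, K (f i)) -> K (\sum_(i < n) f i).
Proof. by move=> /submoduleP[K0 KD _] Kf; elim/big_ind: _. Qed.

Lemma submodule_setT : submodule [set: M].
Proof. exact/submoduleP. Qed.

Lemma submodule_setI K L : submodule K -> submodule L -> submodule (K `&` L).
Proof.
move=> /submoduleP[K0 KD KZ] /submoduleP[L0 LD LZ]; apply/submoduleP; split=> //.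
  by move=> u v [Ku Lu] [Kv Lv]; split; [exact: KD|exact: LD].
by move=> a u [Ku Lu]; split; [exact: KZ|exact: LZ].
Qed.

Lemma two_sided_idealP I :
  two_sided_ideal I <->
  [/\ I 0, forall x y, I x -> I y -> I (x - y),
      forall a x, I x -> I (a * x) & forall a x, I x -> I (x * a)].
Proof.
split=> [[[/set_mem I0 IB] Il Ir]|[I0 IB Il Ir]].
  by split=> // x y Ix Iy; apply/set_mem/IB; apply/mem_set.
split=> //; split; first exact/mem_set.
by move=> x y /set_mem Ix /set_mem Iy; apply/mem_set/IB.
Qed.

Lemma two_sided_ideal_set0 : two_sided_ideal [set (0 : R)].
Proof.
apply/two_sided_idealP; split=> //= [x y -> ->|a x ->|a x ->].
- by rewrite subr0.
- by rewrite mulr0.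
- by rewrite mul0r.
Qed.

Lemma two_sided_ideal_setT : two_sided_ideal [set: R].
Proof. exact/two_sided_idealP. Qed.

Lemma two_sided_ideal_setI I J :
  two_sided_ideal I -> two_sided_ideal J -> two_sided_ideal (I `&` J).
Proof.
move=> /two_sided_idealP[I0 IB Il Ir] /two_sided_idealP[J0 JB Jl Jr].
apply/two_sided_idealP; split=> //.
- by move=> x y [Ix Jx] [Iy Jy]; split; [exact: IB|exact: JB].
- by move=> a x [Ix Jx]; split; [exact: Il|exact: Jl].
- by move=> a x [Ix Jx]; split; [exact: Ir|exact: Jr].
Qed.

(** Serves to build the ideal generated by a family as the intersection of all ideals containing it,
    without forming sums of ideals. *)
Lemma two_sided_ideal_bigcap (G : set (set R)) :
  G `<=` @two_sided_ideal R -> two_sided_ideal (\bigcap_(I in G) I).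
Proof.
move=> Gid; apply/two_sided_idealP; split.
- by move=> I /Gid/two_sided_idealP[].
- move=> x y Hx Hy I GI; have /two_sided_idealP[_ IB _ _] := Gid I GI.
  by apply: IB; [exact: Hx|exact: Hy].
- move=> a x Hx I GI; have /two_sided_idealP[_ _ Il _] := Gid I GI.
  by apply: Il; exact: Hx.
- move=> a x Hx I GI; have /two_sided_idealP[_ _ _ Ir] := Gid I GI.
  by apply: Ir; exact: Hx.
Qed.

(* The annihilator of [M / K]. *)
Definition colon K : set R := [set a | forall m : M, K (a *: m)].

Lemma two_sided_ideal_colon K : submodule K -> two_sided_ideal (colon K).
Proof.
move=> /submoduleP[K0 KD KZ]; apply/two_sided_idealP; split.
- by move=> m; rewrite scale0r.
- move=> x y Kx Ky m; rewrite scalerBl -scalerN.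
  by apply: KD; [exact: Kx|exact: Ky].
- by move=> a x Kx m; rewrite -scalerA; apply: KZ; exact: Kx.
- by move=> a x Kx m; rewrite -scalerA; exact: Kx.
Qed.

Lemma sub_ideal_mul I a (m : M) : I a -> ideal_mul M I (a *: m).
Proof.
by move=> Ia; exists 1%N, (fun=> a), (fun=> m); split=> //; rewrite big_ord1.
Qed.

(** Half of a Galois connection: [K] is closed under finite sums, so only the generators [a *: m] of
    [ideal_mul M I] have to be tested. *)
Lemma ideal_mul_subE I K :
  submodule K -> (ideal_mul M I `<=` K) <-> (I `<=` colon K).
Proof.
move=> sK; split=> [IK a Ia m|IK _ [n [a [m [Ia ->]]]]].
  by apply: IK; exact: sub_ideal_mul.
by apply: submodule_sum => // i; exact: IK.
Qed.

Lemma ideal_mul_setT : ideal_mul M [set: R] = setT.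
Proof.
by apply/seteqP; split=> // m _; rewrite -[m]scale1r; exact: sub_ideal_mul.
Qed.

Lemma coprime_submodule_setI I J K :
  coprime_submodule K -> two_sided_ideal I -> two_sided_ideal J ->
  ideal_mul M (I `&` J) `<=` K -> ideal_mul M I `<=` K \/ ideal_mul M J `<=` K.
Proof.
move=> [sK _ copK] idI idJ; have /submoduleP[K0 KD KZ] := sK.
case: (copK J idJ) => [JKT|]; last by right.
move=> /(ideal_mul_subE _ _ sK) IJK; left; apply/(ideal_mul_subE _ _ sK).
move=> a Ia m.
have /two_sided_idealP[_ _ _ Ir] := idI.
have /two_sided_idealP[_ _ Jl _] := idJ.
(* Decompose [m] as a sum of terms [b i *: x i] plus [k], with [b i] in [J] and [k] in [K]. *)
have : submod_add (ideal_mul M J) K m by rewrite JKT.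
case=> _ [n [b [x [Jb ->]]]] [k Kk <-].
rewrite scalerDr; apply: KD; last exact: KZ.
rewrite scaler_sumr; apply: submodule_sum => // i.
(* The coefficient [a * b i] lies in [I] as a right multiple of [a] and in [J] as a left multiple of
   [b i]. *)
by rewrite scalerA; apply: IJK; split; [exact: Ir|exact: Jl].
Qed.

Lemma ideal_mulS I J : I `<=` J -> ideal_mul M I `<=` ideal_mul M J.
Proof.
by move=> IJ _ [n [a [m [Ia ->]]]]; exists n, a, m; split=> // i; exact: IJ.
Qed.

Lemma SpeccP (K : Specc M) : coprime_submodule (val K).
Proof. by case: K => K /= /set_mem. Qed.

Lemma tau_m_set0 : tau_m M set0.
Proof.
exists (ideal_mul M [set 0]).
  by exists [set 0] => //; exact: two_sided_ideal_set0.
apply/seteqP; split=> // K /=; apply; have [sK _ _] := SpeccP K.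
apply/(ideal_mul_subE _ _ sK) => a /= -> m.
by rewrite scale0r; have /submoduleP[] := sK.
Qed.

Lemma Xc_setT : @Xc R M setT = setT.
Proof.
by apply/seteqP; split=> // K _ /= TK; have [_ + _] := SpeccP K; apply; apply/seteqP.
Qed.

Lemma tau_m_setT : tau_m M setT.
Proof.
exists [set: M]; last exact: Xc_setT.
by exists setT; [exact: two_sided_ideal_setT|rewrite ideal_mul_setT].
Qed.

Lemma tau_m_setI U V : tau_m M U -> tau_m M V -> tau_m M (U `&` V).
Proof.
move=> [_ [I idI ->] <-] [_ [J idJ ->] <-].
exists (ideal_mul M (I `&` J)).
  by exists (I `&` J) => //; exact: two_sided_ideal_setI.
apply/seteqP; split=> K /=.
  move=> IJK; split; apply: contra_not IJK; apply: subset_trans;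
  by apply: ideal_mulS => a [].
by move=> [IK JK] /(coprime_submodule_setI _ _ _ (SpeccP K) idI idJ)[].
Qed.

Lemma tau_m_bigcup (F : set (set (Specc M))) :
  F `<=` tau_m M -> tau_m M (\bigcup_(U in F) U).
Proof.
move=> sF.
(* Taking every ideal whose open set belongs to [F] avoids choosing one ideal per member. The
   intersection [H] is then the ideal sum of all of them. *)
pose gens I := two_sided_ideal I /\ F (Xc (ideal_mul M I)).
pose G := [set J : set R | two_sided_ideal J /\ forall I, gens I -> I `<=` J].
pose H := \bigcap_(J in G) J.
exists (ideal_mul M H).
  by exists H => //; apply: two_sided_ideal_bigcap => J [].
apply/seteqP; split=> K /=; have [sK _ _] := SpeccP K.
  (* If [K] lies in no member of [F], then [colon K] is itself one of the ideals in [G], hence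
     contains [H]. *)
  apply: contra_notP => nK; apply/(ideal_mul_subE _ _ sK) => a; apply.
  split=> [|I [idI FI]]; first exact: two_sided_ideal_colon.
  apply/(ideal_mul_subE _ _ sK); apply: contrapT => IK.
  by apply: nK; exists (Xc (ideal_mul M I)).
move=> [U FU UK]; have [_ [I idI ->] UE] := sF _ FU.
have gI : gens I by split; [exact: idI|rewrite UE].
move: UK; rewrite -UE /=; apply: contra_not; apply: subset_trans.
by apply: ideal_mulS => a Ia J [_]; apply; [exact: gI|].
Qed.

Lemma xi_c_set0 : xi_c M set0.
Proof.
exists [set: M]; first exact: submodule_setT.
(* After complementation both sides agree by conversion, since [Xc] unfolds to the complement of
   [Vc]. *)
by apply: setC_inj; rewrite setC0 -Xc_setT.
Qed.

Lemma xi_c_setU :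
  (forall K, coprime_submodule K -> strongly_irreducible K) ->
  forall U V, xi_c M U -> xi_c M V -> xi_c M (U `|` V).
Proof.
move=> irr _ _ [L1 sL1 <-] [L2 sL2 <-].
exists (L1 `&` L2); first exact: submodule_setI.
apply/seteqP; split=> K /=.
  (* Only this inclusion uses strong irreducibility; the converse holds for any [K]. *)
  by have [_ _] := irr _ (SpeccP K); apply.
by move=> [] LK; apply: subset_trans LK => x [].
Qed.

End Closure.

Theorem theorem5p11 (R : nzRingType) (M : lmodType R)
    (M_neq0 : exists x : M, x != 0) :
  is_topology (tau_m M) /\
  ((forall K : set M, coprime_submodule K -> strongly_irreducible K) ->
   top_c_module M).
Proof.
split=> [|irr F /finite_seqP[s ->] sF].
  split; [exact: tau_m_set0|exact: tau_m_setT|exact: tau_m_setI|].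
  exact: tau_m_bigcup.
(* Finite unions reduce to the empty and binary ones; [big_seq] keeps the membership in [s] needed
   to apply [sF]. *)
rewrite bigcup_seq big_seq; elim/big_ind: _ => [|U V|U sU].
- exact: xi_c_set0.
- exact: xi_c_setU.
- exact: sF.
Qed.
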